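(* Let $\mathcal Q^*$ be the set of all hypercubes in $[0,1]^d$. There exists a constant $C$ depending only on the dimension $d$ such that for all $u,\delta\in(0,1]$ $$\mathcal K\left((\delta u)^{1/2},\rho^*,\{Q\in\mathcal Q^*:|Q|\le\delta\}\right)\le C\,\delta^{-1}u^{-(d+1)} ,$$ i.e. the bound $\mathcal K((\delta u)^{1/2},\rho^*,\{Q\in\mathcal Q^*:|Q|\le\delta\})\le k_1u^{-k_2}\delta^{-v}$ for all $u,\delta\in(0,1]$ holds with $k_1=C$, $k_2=d+1$ and $v=1$.
   Context: $\mathcal Q^*$ consists of all sets $\prod_{i=1}^d[t_i,t_i+h]$ with $t\in[0,1]^d$ and $0<h\le1-\max_{1\le i\le d}t_i$. $|\cdot|$ is Lebesgue measure, $\rho^*(R_1,R_2)=\sqrt{|R_1\bigtriangleup R_2|}$ with $\bigtriangleup$ the symmetric difference. The packing number $\mathcal K(\epsilon,\rho,\mathcal W)$ is the maximal number $m$ of elements $W_1,\dots,W_m\in\mathcal W$ with $\rho(W_i,W_j)>\epsilon$ for all $i\ne j$. *)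

(* Defs.v *)
From HB Require Import structures.
From mathcomp Require Import all_boot all_order all_algebra.
From mathcomp Require Import all_classical all_reals all_analysis.

Set Implicit Arguments.
Unset Strict Implicit.
Unset Printing Implicit Defensive.

Import Order.TTheory GRing.Theory Num.Theory.

Local Open Scope classical_set_scope.
Local Open Scope ring_scope.

(* R^d; [measurableTypeR R] is [R] with its Borel sigma-algebra, so that this
   type carries the product (i.e. Borel) sigma-algebra. *)
Definition space (R : realType) (d : nat) := d.-tuple (measurableTypeR R).

HB.instance Definition _ R d := Measurable.on (space R d).

Definition coord (R : realType) (d : nat) (x : space R d) (i : 'I_d) : R :=
  tnth x i.

Section lebesgue_step.
Context (R : realType) (n : nat).
Variable nu : {sigma_finite_measure set (space R n) -> \bar R}.

Definition space_cons (p : measurableTypeR R * space R n) : space R n.+1 :=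
  [tuple of p.1 :: p.2].

Lemma measurable_space_cons : measurable_fun setT space_cons.
Proof. exact: (@measurable_cons _ _ _ _ fst n snd). Qed.

Definition lebesgue_step : set (space R n.+1) -> \bar R :=
  pushforward (lebesgue_measure \x nu)%E space_cons.

Let mcons := measurable_space_cons.

Let lebesgue_step0 : lebesgue_step set0 = 0%E.
Proof. have m := mcons; exact: measure0. Qed.

Let lebesgue_step_ge0 A : (0 <= lebesgue_step A)%E.
Proof. have m := mcons; exact: measure_ge0. Qed.

Let lebesgue_step_sigma_additive : semi_sigma_additive lebesgue_step.
Proof. have m := mcons; exact: measure_semi_sigma_additive. Qed.

HB.instance Definition _ := isMeasure.Build _ _ _ lebesgue_step
  lebesgue_step0 lebesgue_step_ge0 lebesgue_step_sigma_additive.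

Let split (x : space R n.+1) : measurableTypeR R * space R n :=
  (thead x, [tuple of behead x]).

Let msplit : measurable_fun setT split.
Proof.
apply/measurable_fun_pairP; split.
  exact: (@measurable_tnth _ _ n.+1 ord0).
exact: (@measurable_behead _ (measurableTypeR R) n).
Qed.

Let space_consK : cancel space_cons split.
Proof.
move=> [x y]; rewrite /split /space_cons /=; congr pair.
exact: val_inj.
Qed.

Let lebesgue_step_sigma_finite : sigma_finite setT lebesgue_step.
Proof.
have /sigma_finiteP[F [FT ndF Foo]] := sigma_finiteT (@lebesgue_measure R).
have /sigma_finiteP[G [GT ndG Goo]] := sigma_finiteT nu.
exists (fun k => split @^-1` (F k `*` G k)).
  rewrite -preimage_bigcup (_ : \bigcup_k _ = setT) ?preimage_setT//.
  apply/seteqP; split=> // -[x y] _.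
  have [i _ Fx] : (\bigcup_k F k) x by rewrite -FT.
  have [j _ Gy] : (\bigcup_k G k) y by rewrite -GT.
  exists (maxn i j) => //; split => /=.
    by move: x Fx; exact/subsetPset/ndF/leq_maxl.
  by move: y Gy; exact/subsetPset/ndG/leq_maxr.
move=> k; have [mF Fk] := Foo k; have [mG Gk] := Goo k; split.
  by rewrite -[X in measurable X]setTI; apply: msplit => //; exact: measurableX.
rewrite /lebesgue_step /pushforward -comp_preimage.
rewrite (_ : split \o space_cons = id); last exact/funext/space_consK.
by rewrite preimage_id product_measure1E// lte_mul_pinfty// ge0_fin_numE.
Qed.

HB.instance Definition _ := Measure_isSigmaFinite.Build _ _ _ lebesgue_step
  lebesgue_step_sigma_finite.

End lebesgue_step.

(* Lebesgue measure on R^d, as the d-fold product of [lebesgue_measure]. *)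
Fixpoint lebesgue (R : realType) (d : nat) :
    {sigma_finite_measure set (space R d) -> \bar R} :=
  match d with
  | 0%N => \d_([tuple] : space R 0)
  | n.+1 => lebesgue_step (lebesgue R n)
  end.

Lemma lebesgue_box (R : realType) (d : nat) (a b : 'I_d -> R) :
  (forall i, a i <= b i) ->
  lebesgue R d [set x | forall i, a i <= coord x i <= b i] =
  (\prod_(i < d) (b i - a i))%:E.
Proof.
elim: d a b => [|d IH] a b ab.
  by rewrite big_ord0 /= diracE mem_set// => -[].
rewrite /= /lebesgue_step /pushforward big_ord_recl EFinM.
set B := [set x : space R d |
  forall i, a (lift ord0 i) <= coord x i <= b (lift ord0 i)].
have mB : measurable B.
  rewrite (_ : B = \bigcap_(i in [set: 'I_d])
     ((@tnth d (measurableTypeR R))^~ i @^-1`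
        `[a (lift ord0 i), b (lift ord0 i)])); last first.
    apply/seteqP; split => x /= Bx i; first by move=> _; rewrite /= in_itv; exact: Bx.
    by have := Bx i I; rewrite /= in_itv.
  apply: fin_bigcap_measurable => // i _; rewrite -[X in measurable X]setTI.
  by have := @measurable_tnth _ (measurableTypeR R) d i; apply.
rewrite (_ : _ @^-1` _ = `[a ord0, b ord0] `*` B); last first.
  apply/seteqP; split=> -[x y] /=; rewrite in_itv /=.
    move=> xy; split; first exact: (xy ord0).
    by move=> i; have := xy (lift ord0 i); rewrite /coord tnthS.
  move=> [x0 By] i; case: (unliftP ord0 i) => [j|] ->; last exact: x0.
  by rewrite /coord tnthS; exact: By.
rewrite product_measure1E//= IH => [|i]; last exact: ab.
rewrite lebesgue_measure_itv /= lte_fin; case: ltP => [//|ba].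
by rewrite (@le_anti _ _ (a ord0) (b ord0)) ?ab// subrr.
Qed.

(* The hypercubes in [0,1]^d.  The neutral element 0 of the maximum is harmless
   since all coordinates of [t] are nonnegative. *)
Definition hypercubes (R : realType) (d : nat) : set (set (space R d)) :=
  [set Q | exists (t : space R d) (h : R),
    [/\ forall i, 0 <= coord t i <= 1,
        0 < h,
        h <= 1 - \big[Num.max/0]_(i < d) coord t i &
        Q = [set x | forall i, coord t i <= coord x i <= coord t i + h]]].
Arguments hypercubes R d _ : clear implicits.

Definition rho_star (R : realType) (d : nat) (A B : set (space R d)) : \bar R :=
  sqrte (lebesgue R d (A `+` B)).
Arguments rho_star R d A B : clear implicits.

(* The supremum is +oo when there are arbitrarily large eps-separated families. *)
Definition packing_number (R : realType) (T : Type)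
    (eps : R) (rho : T -> T -> \bar R) (W : set T) : \bar R :=
  ereal_sup [set m%:R%:E | m in
    [set m : nat | exists w : 'I_m -> T, (forall i, W (w i)) /\
       (forall i j, i != j -> (eps%:E < rho (w i) (w j))%E)]].

(* Main.v *)
(* Put s = delta^(1/d) and partition the parameters (t, h) in [0,1]^d x [0,s]
   into cells of side eta = us/(6d).  If two cubes have their parameters in the
   same cell, their symmetric difference is covered by 4d slabs, of total volume
   at most 6d eta s^(d-1) = u delta.  So a separated family has at most one cube
   per cell, and there are at most (1/eta + 1)^d (s/eta + 1)
   <= (7d)^(d+1) / (delta u^(d+1)) cells. *)
Require Import Defs.
From mathcomp Require Import all_boot all_order all_algebra.
From mathcomp Require Import all_classical all_reals all_analysis.
From mathcomp Require Import ring lra.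

Set Implicit Arguments.
Unset Strict Implicit.
Unset Printing Implicit Defensive.

Import Order.TTheory GRing.Theory Num.Theory.
Import Defs.

Local Open Scope classical_set_scope.
Local Open Scope ring_scope.

(** Pigeonhole: two members of a separated family cannot share a cell, so choosing a cell for each
    member is injective. *)
Lemma packing_number_le_card (R : realType) (T : Type) (K : finType) (eps : R)
    (rho : T -> T -> \bar R) (W : set T) (cell : K -> set T) :
  W `<=` \bigcup_k cell k ->
  (forall k A B, cell k A -> cell k B -> (rho A B <= eps%:E)%E) ->
  (packing_number eps rho W <= #|K|%:R%:E)%E.
Proof.
move=> Wcell cellP; apply: ge_ereal_sup => _ [m [w [Ww wsep]] <-].
have /boolp.choice[f fP] : forall i, exists k, cell k (w i).
  by move=> i; have [k _ ?] := Wcell _ (Ww i); exists k.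
rewrite lee_fin ler_nat -[leqLHS]card_ord; apply: (@leq_card _ _ f) => i j fij.
apply/eqP; apply: contraT => /wsep; rewrite ltNge.
by rewrite (cellP (f i)) // fij.
Qed.

(** Equal truncations [n] put both points in [[n * e, (n + 1) * e)]. The signs matter because
    [Num.truncn] sends every negative number to 0. *)
Lemma truncn_eq_dist (R : realType) (e x y : R) : 0 < e -> 0 <= x -> 0 <= y ->
  Num.truncn (x / e) = Num.truncn (y / e) -> `|x - y| <= e.
Proof.
move=> e0 x0 y0 xy; have /truncn_itv : 0 <= x / e by rewrite divr_ge0 // ltW.
have /truncn_itv : 0 <= y / e by rewrite divr_ge0 // ltW.
rewrite xy; set n := Num.truncn _; rewrite -natr1.
rewrite !ler_pdivlMr // !ltr_pdivrMr // mulrDl mul1r => /andP[? ?] /andP[? ?].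
by rewrite ler_norml; lra.
Qed.

Section cubes.
Context (R : realType) (d : nat).
Implicit Types (a b : 'I_d -> R) (t : space R d) (h e : R).

Definition box a b : set (space R d) :=
  [set x | forall i, a i <= coord x i <= b i].

Definition cube t h : set (space R d) :=
  [set x | forall i, coord t i <= coord x i <= coord t i + h].

Lemma measurable_box a b : measurable (box a b).
Proof.
rewrite (_ : box a b = \bigcap_(i in [set: 'I_d])
    ((@tnth d (measurableTypeR R))^~ i @^-1` `[a i, b i])).
  apply: fin_bigcap_measurable => // i _; rewrite -[X in measurable X]setTI.
  by have := @measurable_tnth _ (measurableTypeR R) d i; apply.
apply/seteqP; split=> x /= Bx i; first by rewrite /= in_itv; move: (Bx i).
by have := Bx i I; rewrite /= in_itv.
Qed.

Lemma measurable_cube t h : measurable (cube t h).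
Proof. exact: (measurable_box (coord t) (fun i => coord t i + h)). Qed.

Lemma lebesgue_cube t h : 0 <= h -> lebesgue R d (cube t h) = (h ^+ d)%:E.
Proof.
move=> h0; rewrite (@lebesgue_box _ _ (coord t) (fun i => coord t i + h)).
  by under eq_bigr do rewrite addrAC subrr add0r; rewrite prodr_const card_ord.
by move=> i; rewrite lerDl.
Qed.

Lemma lebesgueU (A B : set (space R d)) : measurable A -> measurable B ->
  (lebesgue R d (A `|` B) <= lebesgue R d A + lebesgue R d B)%E.
Proof. exact: measureU2. Qed.

Definition slab t h (i : 'I_d) p q : set (space R d) :=
  box (fun j => if j == i then p else coord t j)
      (fun j => if j == i then q else coord t j + h).

Lemma lebesgue_slab t h i p q : 0 <= h -> p <= q ->
  lebesgue R d (slab t h i p q) = ((q - p) * h ^+ d.-1)%:E.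
Proof.
move=> h0 pq; rewrite lebesgue_box => [|j]; last by case: ifP; rewrite ?lerDl.
rewrite (bigD1 i) //= eqxx (eq_bigr (fun=> h)) => [|j /negPf ->]; last first.
  by rewrite addrAC subrr add0r.
by rewrite prodr_const cardC1 card_ord.
Qed.

(** A point of the difference leaves the second cube in some direction [i]: either below
    [coord t' i], which is at most [coord t i + e], or above [coord t' i + h'], which is at least
    [coord t i + h - 2e] because corner and side each move by up to [e]. *)
Lemma cubeD_sub_slabs t t' h h' e :
  (forall i, `|coord t i - coord t' i| <= e) -> `|h - h'| <= e ->
  cube t h `\` cube t' h' `<=` \bigcup_(i in [set: 'I_d])
    (slab t h i (coord t i) (coord t i + e) `|`
     slab t h i (coord t i + h - e *+ 2) (coord t i + h)).
Proof.
move=> tt' hh' x [tx /existsNP[i]] /negP.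
rewrite negb_and -!ltNge => t'x; exists i => //.
have := tt' i; rewrite ler_norml => ti.
move: hh'; rewrite ler_norml => hh'; have := tx i.
by case/orP: t'x => xi txi; [left|right] => j /=;
  case: eqP => [->|_]; rewrite ?tx //; lra.
Qed.

Lemma lebesgue_cubeD t t' h h' e : 0 <= h -> 0 <= e ->
  (forall i, `|coord t i - coord t' i| <= e) -> `|h - h'| <= e ->
  (lebesgue R d (cube t h `\` cube t' h') <=
    (d%:R * (3 * e * h ^+ d.-1))%:E)%E.
Proof.
move=> h0 e0 tt' hh'.
pose S i := slab t h i (coord t i) (coord t i + e) `|`
  slab t h i (coord t i + h - e *+ 2) (coord t i + h).
(* The two slabs in direction [i] have widths [e] and [2e], whence the factor 3. *)
have Sle i : measurable (S i) /\
    (lebesgue R d (S i) <= (3 * e * h ^+ d.-1)%:E)%E.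
  split; first by apply: measurableU; exact: measurable_box.
  apply: (le_trans (lebesgueU _ _)); [exact: measurable_box..|].
  rewrite !lebesgue_slab ?lerDl ?gerBl ?mulrn_wge0 //.
  by rewrite -EFinD lee_fin le_eqVlt; apply/orP; left; apply/eqP; ring.
have [mS USle] : measurable (\bigcup_(i in [set: 'I_d]) S i) /\
    (lebesgue R d (\bigcup_(i in [set: 'I_d]) S i) <=
      (\sum_(i < d) 3 * e * h ^+ d.-1)%:E)%E.
  have -> : [set: 'I_d] = [set` predT] by apply/seteqP.
  rewrite bigcup_pred.
  (* Measurability is carried along with the bound, since subadditivity needs it for the partial
     unions. *)
  elim/big_ind2: _ => [|A x B y [mA Ax] [mB By]|i _]; last exact: Sle.
    by rewrite measure0.
  split; first exact: measurableU.
  by apply: (le_trans (lebesgueU mA mB)); rewrite EFinD leeD.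
rewrite (_ : d%:R * _ = \sum_(i < d) 3 * e * h ^+ d.-1); last first.
  by rewrite sumr_const card_ord mulr_natl.
apply: le_trans USle; apply: le_measure; rewrite ?inE //.
  by apply: measurableD; exact: measurable_cube.
exact: cubeD_sub_slabs.
Qed.

(** Each of the two one-sided differences has volume at most [3 * d * e * s ^ (d - 1)]; the two add
    up to the factor 6. *)
Lemma rho_star_cube t t' h h' s e : 0 <= h <= s -> 0 <= h' <= s -> 0 <= e ->
  (forall i, `|coord t i - coord t' i| <= e) -> `|h - h'| <= e ->
  (rho_star R d (cube t h) (cube t' h') <=
    ((6 * d%:R * e * s ^+ d.-1) `^ 2^-1)%:E)%E.
Proof.
move=> /andP[h0 hs] /andP[h'0 h's] e0 tt' hh'.
have s0 : 0 <= s := le_trans h0 hs.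
have K0 : 0 <= 6 * d%:R * e * s ^+ d.-1 by rewrite !mulr_ge0 ?exprn_ge0.
rewrite /rho_star powR12_sqrt // -[leRHS]/(sqrte (_%:E)) lee_sqrt ?lee_fin //.
apply: (le_trans (lebesgueU _ _));
  [by apply: measurableD; exact: measurable_cube..|].
have l1 := lebesgue_cubeD h0 e0 tt' hh'.
have l2 : (lebesgue R d (cube t' h' `\` cube t h) <=
    (d%:R * (3 * e * h' ^+ d.-1))%:E)%E.
  by apply: lebesgue_cubeD => // [i|]; rewrite distrC.
apply: (le_trans (leeD l1 l2)); rewrite -EFinD lee_fin.
have p1 : h ^+ d.-1 <= s ^+ d.-1 by rewrite lerXn2r.
have p2 : h' ^+ d.-1 <= s ^+ d.-1 by rewrite lerXn2r.
have de : 0 <= 3 * d%:R * e by rewrite !mulr_ge0.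
have := ler_wpM2l de p1; have := ler_wpM2l de p2; lra.
Qed.

(** A cell of the parameter grid of mesh [e], transported to sets of cubes. The successors make room
    for the last index, which may be reached when a coordinate is 1 or the side is [s]. *)
Definition cube_cell (N M : nat) s e (k : {ffun 'I_d -> 'I_N.+1} * 'I_M.+1) :
    set (set (space R d)) :=
  [set Q | exists t h, [/\ forall i, 0 <= coord t i,
     forall i, Num.truncn (coord t i / e) = k.1 i,
     0 <= h <= s, Num.truncn (h / e) = k.2 & Q = cube t h]].

Lemma hypercubes_sub_cells (delta s e : R) : (0 < d)%N -> 0 < e -> 0 <= s ->
  s ^+ d = delta ->
  [set Q | hypercubes R d Q /\ (lebesgue R d Q <= delta%:E)%E] `<=`
  \bigcup_k @cube_cell (Num.truncn e^-1) (Num.truncn (s / e)) s e k.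
Proof.
move=> d_gt0 e0 s0 sd _ [[t [h [t01 h0 _ ->]]]].
rewrite -/(cube t h) lebesgue_cube ?lee_fin; last exact: ltW.
(* The volume bound reads [h ^ d <= s ^ d], hence [h <= s] as [d > 0]. *)
rewrite -sd ler_pXn2r // ?nnegrE; last exact: ltW.
move=> hs; exists ([ffun i => inord (Num.truncn (coord t i / e))],
                   inord (Num.truncn (h / e))) => //.
exists t, h; split => //=.
- by move=> i; have /andP[] := t01 i.
(* [inord] does not fall back on its default: [coord t i <= 1] keeps the index within range, as
   [h <= s] does for the side below. *)
- move=> i; rewrite ffunE inordK // ltnS; apply: le_truncn.
  by rewrite ler_pdivrMr // mulVf ?gt_eqF //; have /andP[] := t01 i.
- by rewrite ltW.
- rewrite inordK // ltnS; apply: le_truncn.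
  by rewrite ler_pM2r // invr_gt0.
Qed.

Lemma rho_star_cube_cell N M s e (k : {ffun 'I_d -> 'I_N.+1} * 'I_M.+1) A B :
  0 < e -> cube_cell s e k A -> cube_cell s e k B ->
  (rho_star R d A B <= ((6 * d%:R * e * s ^+ d.-1) `^ 2^-1)%:E)%E.
Proof.
move=> e0 [t [h [t0 tk hs hk ->]]] [t' [h' [t'0 t'k h's h'k ->]]].
apply: rho_star_cube => //; first exact: ltW.
  by move=> i; apply: truncn_eq_dist; rewrite ?tk ?t'k.
by apply: truncn_eq_dist; rewrite ?hk ?h'k //; [case/andP: hs|case/andP: h's].
Qed.

End cubes.

Lemma truncnS_le (R : realType) (x y : R) : 0 <= x -> x + 1 <= y ->
  (Num.truncn x).+1%:R <= y.
Proof.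
by move=> /truncn_itv/andP[xx _]; apply: le_trans; rewrite -natr1 lerD2r.
Qed.

Theorem lemmaA3 (R : realType) (d : nat) (d_gt0 : (0 < d)%N) :
  exists C : R, forall u delta : R, 0 < u <= 1 -> 0 < delta <= 1 ->
    (packing_number ((delta * u) `^ 2^-1) (rho_star R d)
       [set Q | hypercubes R d Q /\ (lebesgue R d Q <= delta%:E)%E]
     <= (C * delta^-1 * u ^- d.+1)%:E)%E.
Proof.
exists ((7 * d%:R) ^+ d.+1) => u delta /andP[u0 u1] /andP[delta0 delta1].
pose s := delta `^ d%:R^-1.
have s0 : 0 < s by rewrite powR_gt0.
have sd : s ^+ d = delta.
  rewrite -powR_mulrn ?ltW // -powRrM mulVf ?pnatr_eq0 -?lt0n //.
  by rewrite powRr1 // ltW.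
(* Needed for [u * s <= 1] in the count of corner positions. *)
have s1 : s <= 1.
  rewrite -(@ler_pXn2r _ d) ?sd ?expr1n ?nnegrE //; exact: ltW.
have D1 : 1 <= d%:R :> R by rewrite ler1n.
have D0 : 0 < d%:R :> R by rewrite ltr0n.
pose e := u * s / (6 * d%:R).
have e0 : 0 < e by rewrite divr_gt0 ?mulr_gt0.
have eE : 6 * d%:R * e * s ^+ d.-1 = delta * u.
  rewrite -sd -[in RHS](prednK d_gt0) exprS /e.
  by field; rewrite gt_eqF.
rewrite -eE.
apply: (le_trans (packing_number_le_card
  (hypercubes_sub_cells d_gt0 e0 (ltW s0) sd) _)).
  by move=> k A B; exact: rho_star_cube_cell.
rewrite lee_fin card_prod card_ffun !card_ord natrM natrX.
have us0 : 0 < u * s by rewrite mulr_gt0.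
(* Since [1 <= d / x], the extra cell turns 6 into 7. This is used with [x = u * s] for each corner
   coordinate and [x = u] for the side. *)
have bound (x : R) : 0 < x <= 1 -> 6 * d%:R / x + 1 <= 7 * d%:R / x.
  move=> /andP[x0 x1]; rewrite ler_pdivlMr // mulrDl mul1r divfK ?gt_eqF //.
  lra.
have bN : (Num.truncn e^-1).+1%:R <= 7 * d%:R / (u * s).
  apply: truncnS_le; first by rewrite invr_ge0 ltW.
  by rewrite invf_div bound // us0 mulr_ile1 // ltW.
have bM : (Num.truncn (s / e)).+1%:R <= 7 * d%:R / u.
  apply: truncnS_le; first by rewrite divr_ge0 // ltW.
  rewrite (_ : s / e = 6 * d%:R / u) ?bound ?u0 //.
  by rewrite /e; field; rewrite !gt_eqF.
apply: (@le_trans _ _ ((7 * d%:R / (u * s)) ^+ d * (7 * d%:R / u))).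
  by apply: ler_pM => //;
    rewrite ?exprn_ge0 // lerXn2r ?nnegrE // (le_trans _ bN).
(* Equality holds, because [(u * s) ^ d * u = delta * u ^ (d + 1)]. *)
rewrite le_eqVlt; apply/orP; left; apply/eqP.
rewrite expr_div_n [(u * s) ^+ _]exprMn sd !exprS.
by field; rewrite ?expf_neq0 ?gt_eqF.
Qed.
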